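(* Let $G=(V,E)$ be a directed acyclic graph, let $\overline{G}$ be the complement of $G$ and $\overline{G^*}$ the complement of the transitive closure $G^*$ of $G$. If $H$ is a transitive orientation of $\overline{G}$, then $H\cap\overline{G^*}$ (the graph on $V$ whose edges are those edges of $H$ that are also edges of $\overline{G^*}$) is a transitive orientation of $\overline{G^*}$.
   Context: All graphs are simple and directed; an undirected edge is represented as a pair of opposite directed edges. For $G=(V,E)$, $E^{-1}=\{(b,a)\mid (a,b)\in E\}$, and the complement of $G$ is the graph $(V,\{(a,b)\mid a,b\in V,\ a\neq b\}\setminus (E\cup E^{-1}))$. A graph is transitive if $(a,b),(b,c)\in E$ with $a\neq c$ implies $(a,c)\in E$; the transitive closure $G^*=(V,E^* )$ has $E^*$ the minimal transitive superset of $E$. A graph $(V,E)$ is oriented if $E\cap E^{-1}=\emptyset$; a graph $(V,E')$ is an orientation of $(V,E)$ if $E'$ is a maximal oriented subset of $E$. A transitive orientation is an orientation that is a transitive graph. *)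

(* Defs.v *)
From Stdlib Require Import List Relations Sorted.

Set Implicit Arguments.

(** Simple directed graphs on an arbitrary, possibly infinite, vertex type.
    An undirected edge is a pair of opposite edges. *)
Record digraph (V : Type) := Digraph {
  edge : relation V;
  edge_irrefl : forall a, ~ edge a a
}.

Definition subgraph (V : Type) (G K : digraph V) : Prop :=
  inclusion V (edge G) (edge K).

(** [Sorted] only relates consecutive entries, so this says that the list
    [a :: l] of distinct vertices is a directed path whose last vertex has an
    edge back to [a].  Since graphs are loopless, [l] cannot be empty; a pair
    of opposite edges is a cycle. *)
Definition directed_cycle (V : Type) (G : digraph V) (a : V) (l : list V) : Prop :=
  NoDup (a :: l) /\ Sorted (edge G) (a :: l) /\ edge G (last l a) a.

Definition acyclic (V : Type) (G : digraph V) : Prop :=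
  forall a l, ~ directed_cycle G a l.

Definition complement (V : Type) (G : digraph V) : digraph V.
Proof.
refine {| edge := fun a b => a <> b /\ ~ (edge G a b \/ edge G b a) |}.
intros a [H _]; exact (H eq_refl).
Defined.

(** Unlike for [Relations.transitive], the endpoints must be distinct, so a
    transitive graph may contain pairs of opposite edges. *)
Definition transitive_graph (V : Type) (G : digraph V) : Prop :=
  forall a b c, edge G a b -> edge G b c -> a <> c -> edge G a c.

(** The intersection of all transitive graphs containing [G]; it is loopless
    because the complete graph is one of them. *)
Definition transitive_closure (V : Type) (G : digraph V) : digraph V.
Proof.
refine {| edge := fun a b =>
  forall K : digraph V, subgraph G K -> transitive_graph K -> edge K a b |}.
intros a H.
assert (irr : forall x : V, ~ x <> x) by (intros x Hx; exact (Hx eq_refl)).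
refine (H (Digraph (fun x y => x <> y) irr) _ _ eq_refl).
- intros x y Hxy Heq; subst y; exact (edge_irrefl G x Hxy).
- intros x y z _ _ Hxz; exact Hxz.
Defined.

Lemma transitive_closure_least (V : Type) (G : digraph V) :
  subgraph G (transitive_closure G) /\
  transitive_graph (transitive_closure G) /\
  forall K, subgraph G K -> transitive_graph K ->
    subgraph (transitive_closure G) K.
Proof.
split; [|split].
- intros a b Hab K HGK _; exact (HGK a b Hab).
- intros a b c Hab Hbc Hac K HGK HK.
  exact (HK a b c (Hab K HGK HK) (Hbc K HGK HK) Hac).
- intros K HGK HK a b Hab; exact (Hab K HGK HK).
Qed.

Definition intersection (V : Type) (G K : digraph V) : digraph V.
Proof.
refine {| edge := fun a b => edge G a b /\ edge K a b |}.
intros a [H _]; exact (edge_irrefl G a H).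
Defined.

Definition oriented (V : Type) (G : digraph V) : Prop :=
  forall a b, ~ (edge G a b /\ edge G b a).

(** [orientation G H]: the graph [H] is an orientation of [G]. *)
Definition orientation (V : Type) (G H : digraph V) : Prop :=
  subgraph H G /\ oriented H /\
  forall K, subgraph K G -> oriented K -> subgraph H K -> subgraph K H.

Definition transitive_orientation (V : Type) (G H : digraph V) : Prop :=
  orientation G H /\ transitive_graph H.

(* Main.v *)
(** Let [b] be incomparable in [G^*] to both ends of a [G]-path.  Then [b] is
    incomparable in [G^*] to every vertex of the path, and [H] orients all the
    pairs between [b] and the path the same way: if [H] pointed into [b] from
    one end of an edge of [G] and out of [b] to its other end, transitivity
    would put that edge of [G] in [H].  So for edges [(a,b)] and [(b,c)] of
    the intersection no [G]-path joins [a] and [c]. *)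

From Stdlib Require Import Relations Classical.
Require Import Defs.

Set Implicit Arguments.
Unset Strict Implicit.

Lemma complement_sym (V : Type) (G : digraph V) (a b : V) :
  edge (complement G) a b -> edge (complement G) b a.
Proof. simpl; firstorder. Qed.

Lemma complement_subgraph (V : Type) (G K : digraph V) :
  subgraph G K -> subgraph (complement K) (complement G).
Proof.
intros HGK a b [Hab Hn]; split; [exact Hab|].
intros [H|H]; apply Hn; [left|right]; exact (HGK _ _ H).
Qed.

(** Reachability between distinct vertices is itself a transitive graph containing [G], so
    minimality gives one direction; the other is induction along the path. *)
Lemma transitive_closureP (V : Type) (G : digraph V) (a b : V) :
  edge (transitive_closure G) a b <-> a <> b /\ clos_refl_trans V (edge G) a b.
Proof.
split.
- intros H.
  assert (irr : forall x, ~ (x <> x /\ clos_refl_trans V (edge G) x x))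
    by (intros x [Hx _]; exact (Hx eq_refl)).
  apply (H (Digraph (fun x y => x <> y /\ clos_refl_trans V (edge G) x y) irr)).
  + intros x y Hxy; split; [|apply rt_step; exact Hxy].
    intros <-; exact (edge_irrefl G x Hxy).
  + intros x y z [_ Hxy] [_ Hyz] Hxz; split; [exact Hxz|].
    exact (rt_trans _ _ _ _ _ Hxy Hyz).
- intros [Hab Hpath] K HGK HK.
  apply clos_rt_rt1n in Hpath; revert Hab.
  induction Hpath as [x|x y z Hxy _ IH]; intros Hxz; [now destruct Hxz|].
  (* The induction hypothesis covers distinct vertices only, so the case where the first edge
     already ends at [z] is treated apart. *)
  destruct (classic (y = z)) as [<-|Hyz]; [exact (HGK _ _ Hxy)|].
  exact (HK _ _ _ (HGK _ _ Hxy) (IH Hyz) Hxz).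
Qed.

(** If [(b,a)] is not in [H], adding [(a,b)] to [H] leaves it oriented and inside [G], so maximality
    forces [(a,b)] into [H]. *)
Lemma orientation_total (V : Type) (G H : digraph V) (a b : V) :
  orientation G H -> edge G a b -> edge H a b \/ edge H b a.
Proof.
intros [HsubG [Hor Hmax]] Hab.
destruct (classic (edge H b a)) as [Hba|Hba]; [now right|left].
assert (irr : forall x, ~ (edge H x x \/ x = a /\ x = b)).
{ intros x [Hx|[-> ->]]; [exact (edge_irrefl H x Hx)|].
  exact (edge_irrefl G b Hab). }
apply (Hmax (Digraph (fun x y => edge H x y \/ x = a /\ y = b) irr)).
- intros x y [Hxy|[-> ->]]; [exact (HsubG _ _ Hxy)|exact Hab].
- intros x y [[Hxy|[-> ->]] [Hyx|[E1 E2]]]; subst.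
  + exact (Hor x y (conj Hxy Hyx)).
  + exact (Hba Hxy).
  + exact (Hba Hyx).
  + exact (edge_irrefl G _ Hab).
- intros x y Hxy; now left.
- now right.
Qed.

Lemma transitive_orientation_edge (V : Type) (G H : digraph V) (u v b : V) :
  transitive_orientation (complement G) H -> edge G u v ->
  edge (complement G) u b -> edge (complement G) v b ->
  (edge H u b <-> edge H v b).
Proof.
intros [HO HT] Huv Hub Hvb.
assert (Hne : u <> v) by (intros <-; exact (edge_irrefl G u Huv)).
assert (HsubG := proj1 HO).
split; intros He.
- destruct (orientation_total HO Hvb) as [|Hbv]; [assumption|exfalso].
  destruct (HsubG _ _ (HT _ _ _ He Hbv Hne)) as [_ Hn]; tauto.
- destruct (orientation_total HO Hub) as [|Hbu]; [assumption|exfalso].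
  destruct (HsubG _ _ (HT _ _ _ He Hbu (not_eq_sym Hne))) as [_ Hn]; tauto.
Qed.

(** If [v] equals or reaches [b], then so does [x], through [v]; if [b] reaches [v], then it reaches
    [y]. Either way an end of the path would be comparable to [b]. *)
Lemma complement_closure_between (V : Type) (G : digraph V) (x v y b : V) :
  clos_refl_trans V (edge G) x v -> clos_refl_trans V (edge G) v y ->
  edge (complement (transitive_closure G)) x b ->
  edge (complement (transitive_closure G)) y b ->
  edge (complement (transitive_closure G)) v b.
Proof.
intros Hxv Hvy [Hxb Hnx] [Hyb Hny].
split; [intros ->|intros [Hvb|Hbv]].
- apply Hnx; left; apply transitive_closureP; now split.
- apply transitive_closureP in Hvb as [_ Hvb].
  apply Hnx; left; apply transitive_closureP; split; [exact Hxb|].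
  exact (rt_trans _ _ _ _ _ Hxv Hvb).
- apply transitive_closureP in Hbv as [_ Hbv].
  apply Hny; right; apply transitive_closureP.
  split; [exact (not_eq_sym Hyb)|].
  exact (rt_trans _ _ _ _ _ Hbv Hvy).
Qed.

Lemma transitive_orientation_path (V : Type) (G H : digraph V) (x y b : V) :
  transitive_orientation (complement G) H ->
  clos_refl_trans V (edge G) x y ->
  edge (complement (transitive_closure G)) x b ->
  edge (complement (transitive_closure G)) y b ->
  (edge H x b <-> edge H y b).
Proof.
intros HH Hpath; apply clos_rt_rt1n in Hpath.
induction Hpath as [x|x v y Hxv Hvy IH]; intros Hxb Hyb; [reflexivity|].
apply clos_rt1n_rt in Hvy.
assert (Hvb := complement_closure_between (rt_step _ _ _ _ Hxv) Hvy Hxb Hyb).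
(* Complementing reverses inclusion, so incomparable vertices are non-adjacent in [G] and the
   one-edge lemma applies to them. *)
assert (Hsub := complement_subgraph (proj1 (transitive_closure_least G))).
rewrite <- (IH Hvb Hyb).
exact (transitive_orientation_edge HH Hxv (Hsub _ _ Hxb) (Hsub _ _ Hvb)).
Qed.

Theorem theorem8 (V : Type) (G : digraph V) (HG : acyclic G) (H : digraph V)
  (HH : transitive_orientation (complement G) H) :
  transitive_orientation (complement (transitive_closure G))
    (intersection H (complement (transitive_closure G))).
Proof.
assert (Hsub := complement_subgraph (proj1 (transitive_closure_least G))).
destruct (HH) as [HO HT].
assert (Hor := proj1 (proj2 HO)).
split; [split; [|split]|].
- intros a b [_ Hab]; exact Hab.
- intros a b [[Hab _] [Hba _]]; exact (Hor a b (conj Hab Hba)).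
- intros K HK HKor HinK a b Hab.
  split; [|exact (HK _ _ Hab)].
  (* If [H] orients the pair as [(b,a)], the intersection contains [(b,a)] and hence so does [K],
     next to [(a,b)]: [K] is not oriented. *)
  destruct (orientation_total HO (Hsub _ _ (HK _ _ Hab))) as [|Hba]; [assumption|].
  destruct (HKor a b); split; [exact Hab|].
  apply HinK; split; [exact Hba|exact (complement_sym (HK _ _ Hab))].
- intros a b c [Hab Cab] [Hbc Cbc] Hac.
  apply complement_sym in Cbc.
  split; [exact (HT _ _ _ Hab Hbc Hac)|split; [exact Hac|]].
  (* A path between [a] and [c], in either direction, carries the edge [(a,b)] of [H] over to
     [(c,b)], which is opposite to [(b,c)]. *)
  intros [P|P]; apply transitive_closureP in P as [_ P].
  + apply (Hor b c); split; [exact Hbc|].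
    exact (proj1 (transitive_orientation_path HH P Cab Cbc) Hab).
  + apply (Hor b c); split; [exact Hbc|].
    exact (proj2 (transitive_orientation_path HH P Cbc Cab) Hab).
Qed.
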